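(* If $X,Y$ are weakly homeomorphic perfectly paracompact spaces, then (1) $nw(X)=nw(Y)$; (2) $hl(X)=hl(Y)$; (3) $hd(X)=hd(Y)$; (4) $\dim X=\dim Y$; (5) $X$ is analytic if and only if $Y$ is analytic; (6) $X$ is $\sigma$-compact if and only if $Y$ is $\sigma$-compact; (7) $X$ is $\sigma$-Polish if and only if $Y$ is $\sigma$-Polish.
   Context: A map $f:X\to Y$ between topological spaces (not necessarily continuous) is weakly discontinuous if each subspace $A\subset X$ contains a relatively open dense subset $U\subset A$ such that the restriction $f|U$ is continuous. A weak homeomorphism is a bijective map $f$ such that both $f$ and $f^{-1}$ are weakly discontinuous; two spaces are weakly homeomorphic if there is a weak homeomorphism between them. A space is perfectly paracompact if it is paracompact (which includes Hausdorff, as in Engelking's book) and each of its open subsets is of type $F_\sigma$. The network weight $nw(X)$ is the smallest cardinality of a family $\mathcal N$ of subsets of $X$ such that for each $x\in X$ and each neighborhood $U$ of $x$ there is $N\in\mathcal N$ with $x\in N\subset U$. The hereditary Lindelöf number $hl(X)$ is the smallest cardinal $\kappa$ such that each open cover of any subspace of $X$ has a subcover of cardinality $\le\kappa$. The hereditary density $hd(X)$ is the smallest cardinal $\kappa$ such that each subspace of $X$ contains a dense subset of cardinality $\le\kappa$. $\dim$ is the covering dimension. A space is analytic if it is a continuous image of a Polish (= separable completely metrizable) space; $\sigma$-compact if it is a countable union of compact subsets; $\sigma$-Polish if it is a countable union of closed Polish subspaces. *)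

(* Defs.v *)
From HB Require Import structures.
From mathcomp Require Import all_boot all_order all_algebra.
From mathcomp Require Import all_classical all_reals all_analysis.
From mathcomp Require Import borel_hierarchy.

Set Implicit Arguments.
Unset Strict Implicit.
Unset Printing Implicit Defensive.

Import Order.TTheory GRing.Theory Num.Theory.

Local Open Scope classical_set_scope.
Local Open Scope card_scope.
Local Open Scope ring_scope.

(* A subspace of X is [set_type A] for A : set X (the coercion is implicit     *)
(* below), which carries the topology induced by the inclusion [set_val].      *)

Definition weakly_discontinuous (X Y : topologicalType) (f : X -> Y) : Prop :=
  forall A : set X, exists U : set A,
    [/\ open U, dense U & {within set_val @` U, continuous f}].

Definition weakly_homeomorphic (X Y : topologicalType) : Prop :=
  exists (f : X -> Y) (g : Y -> X),
    [/\ cancel f g, cancel g f,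
        weakly_discontinuous f & weakly_discontinuous g].

Section Covers.
Variable X : topologicalType.
Implicit Types U V : set (set X).

Definition open_cover U : Prop :=
  (forall O, U O -> open O) /\ \bigcup_(O in U) O = [set: X].

Definition refines V U : Prop :=
  forall B, V B -> exists2 A, U A & B `<=` A.

Definition locally_finite V : Prop :=
  forall x : X, exists2 W : set X,
    nbhs x W & finite_set [set B | V B /\ B `&` W !=set0].

End Covers.

Definition paracompact (X : topologicalType) : Prop :=
  hausdorff_space X /\
  forall U : set (set X), open_cover U ->
    exists V : set (set X), [/\ open_cover V, refines V U & locally_finite V].

Definition perfectly_paracompact (X : topologicalType) : Prop :=
  paracompact X /\ forall O : set X, open O -> Fsigma O.

(* A cardinal is represented by a type K, up to equipotence of [set: K].       *)
Definition least_cardinal (P : Type -> Prop) (K : Type) : Prop :=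
  P K /\ forall L : Type, P L -> [set: K] #<= [set: L].

Definition network (X : topologicalType) (N : set (set X)) : Prop :=
  forall (x : X) (U : set X), nbhs x U ->
    exists2 B : set X, N B & B x /\ B `<=` U.

(* The predicates [is_nw X], [is_hl X], [is_hd X] of a type K say that the     *)
(* cardinal of K is nw(X), hl(X), hd(X); finite values are allowed.            *)

Definition is_nw (X : topologicalType) : Type -> Prop :=
  least_cardinal (fun K =>
    exists2 N : set (set X), network N & N #= [set: K]).

Definition is_hl (X : topologicalType) : Type -> Prop :=
  least_cardinal (fun K =>
    forall (A : set X) (U : set (set A)), open_cover U ->
      exists V : set (set A), [/\ V `<=` U, open_cover V & V #<= [set: K]]).

Definition is_hd (X : topologicalType) : Type -> Prop :=
  least_cardinal (fun K =>
    forall A : set X, exists2 D : set A, dense D & D #<= [set: K]).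

(* dim X < n, i.e. dim X <= n - 1: every finite open cover has a finite open   *)
(* refinement of order at most n - 1, where a family has order at most n - 1   *)
(* when no point belongs to more than n of its members.                        *)
Definition covering_dim_lt (X : topologicalType) (n : nat) : Prop :=
  forall U : set (set X), finite_set U -> open_cover U ->
    exists V : set (set X),
      [/\ finite_set V, open_cover V, refines V U &
          forall x : X, [set B | V B /\ B x] #<= `I_n].

(* Values are -1 (exactly for the empty space), 0, 1, ..., +oo.                *)
Definition covering_dim (X : topologicalType) : \bar int :=
  match pselect (exists n, `[< covering_dim_lt X n >]) with
  | left ex => ((ex_minn ex)%:Z - 1)%:E
  | right _ => +oo%E
  end.

Definition homeomorphic (X Y : topologicalType) : Prop :=
  exists (f : X -> Y) (g : Y -> X),
    [/\ cancel f g, cancel g f, continuous f & continuous g].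

Definition separable (X : topologicalType) : Prop :=
  exists2 D : set X, countable D & dense D.

(* The library's [completeType] is pointed; this version admits the empty      *)
(* space.                                                                      *)
Definition complete_metric (R : realType) (M : metricType R) : Prop :=
  forall F : set_system M, ProperFilter F -> cauchy F -> exists x : M, F --> x.

Definition polish (R : realType) (X : topologicalType) : Prop :=
  separable X /\
  exists M : metricType R, complete_metric M /\ homeomorphic M X.

Definition analytic (R : realType) (X : topologicalType) : Prop :=
  exists (P : topologicalType) (f : P -> X),
    [/\ polish R P, continuous f & range f = [set: X]].

Definition sigma_compact (X : topologicalType) : Prop :=
  exists2 F : (set X)^nat,
    (forall i, compact (F i)) & \bigcup_i F i = [set: X].

Definition sigma_polish (R : realType) (X : topologicalType) : Prop :=
  exists2 F : (set X)^nat,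
    (forall i, closed (F i) /\ polish R (F i)) & \bigcup_i F i = [set: X].

(* Main.v *)
Require Import Defs.
From HB Require Import structures.
From mathcomp Require Import all_boot all_order all_algebra.
From mathcomp Require Import all_classical all_reals all_analysis.

(** The bridge between X and Y is a decomposition into countably many closed
    pieces on which the weak homeomorphism is a homeomorphism.

    A weakly discontinuous map f on a perfectly paracompact space X is
    continuous on each member of a countable closed cover of X
    ([weakly_discontinuous_sigma_continuous]).  Call an open set good if it is
    a countable union of closed sets on which f is continuous.  A union of good
    open sets is good: it is an F_sigma, each of its closed parts is covered by
    a locally finite refinement, and f is continuous on a locally finite union
    of closed sets on each of which it is continuous.  So there is a largest
    good open set G.  If G were not the whole space, weak discontinuity on the
    complement of G would yield a nonempty relatively open U there with f
    continuous on U, and the union of G and U would be a larger good open set.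
    This replaces a transfinite peeling of X by a single maximality argument.

    Applied to f and to its inverse g, with covers A_n of X and B_m of Y, this
    makes the sets A_n /\ f^-1(B_m) a countable closed cover of X whose images
    are a closed cover of Y, f being a homeomorphism from each piece to its
    image ([weakly_homeomorphic_sigma_homeo]).  Every invariant in the theorem
    survives restriction to closed subspaces, homeomorphisms and countable
    closed unions:

    - For nw, hl and hd, a witness of size K for X gives one of size
      aleph_0 * K for Y, and aleph_0 * K = K when K is infinite
      ([card_nat_mul]).  If K is finite, testing the invariant on finite
      subspaces, which are discrete, shows that X has at most K points, and
      then so has Y.
    - Paracompact Hausdorff spaces are normal ([paracompact_normal]), and for
      dim this is the countable closed sum theorem in normal spaces
      ([dim_countable_sum]).
    - A countable union of analytic pieces f(p(P_n)), with P_n closed in one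
      Polish space P, is the image of a closed subset of the Polish space
      nat * P ([analytic_transfer]).
    - For sigma-compactness and sigma-Polishness, the given countable cover is
      intersected with the pieces and carried to Y by f. *)

Set Implicit Arguments.
Unset Strict Implicit.
Unset Printing Implicit Defensive.
Import Order.TTheory GRing.Theory Num.Theory.
Local Open Scope classical_set_scope.
Local Open Scope card_scope.

(** * Comparing cardinalities of types *)

(** Comparing cardinals through an injective total relation rather than a
    function needs no default value in the target and hides the coercions
    between a set and its type of elements. *)
Lemma card_le_relP T U (A : set T) (B : set U) :
  A #<= B <-> exists r : T -> U -> Prop,
    (forall a, A a -> exists2 b, B b & r a b) /\
    (forall a a' b, A a -> A a' -> r a b -> r a' b -> a = a').
Proof.
split=> [/card_leP[h]|[r [rt ri]]].
  exists (fun a b => exists2 d : A, set_val d = a & set_val (h d) = b).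
  split=> [a Aa|a a' b _ _ [d <- <-] [d' <- /val_inj E]].
    exists (set_val (h (SigSub (mem_set Aa)))); first exact: set_valP.
    by exists (SigSub (mem_set Aa)).
  by congr set_val; apply/esym/(@inj _ _ _ h); rewrite ?inE.
have rt' (a : A) : exists b : B, r (set_val a) (set_val b).
  have [b Bb rb] := rt _ (set_valP a).
  by exists (SigSub (mem_set Bb)).
have [h hP] := choice rt'.
apply/card_leP/injfunPex; exists h => // a a' _ _ E.
apply/val_inj/(ri _ _ (set_val (h a)));
  [exact: set_valP|exact: set_valP|exact: hP|].
by rewrite E; exact: hP.
Qed.

Lemma inj_card_leT T U (f : T -> U) : injective f -> [set: T] #<= [set: U].
Proof.
move=> fi; apply/card_le_relP; exists (fun a b => f a = b); split=> [a _|a a' b _ _ <-].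
  by exists (f a).
by move=> /fi.
Qed.

(** Honig's argument for the well-ordering of cardinals: take a maximal set S
    of elements of the product of the T i whose coordinates are all injective
    on S. If every coordinate missed some point, those points would form an
    element that could be added to S; so some T i is exhausted by its
    coordinate on S, and s i |-> s j embeds it in every T j. *)
Lemma exists_least_card (I : Type) (T : I -> Type) (i0 : I) :
  exists i, forall j, [set: T i] #<= [set: T j].
Proof.
pose P (S : set (forall i, T i)) :=
  forall i s t, S s -> S t -> s i = t i -> s = t.
have [F FP Ftot|S [PS Smax]] := @Zorn_bigcup _ P.
  move=> i s t [A FA As] [B FB Bt].
  by have [AB|BA] := Ftot _ _ FA FB; [apply: (FP _ FB)|apply: (FP _ FA)] => //;
    [exact: AB|exact: BA].
have [i Si] : exists i, forall a : T i, exists2 s, S s & s i = a.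
  apply: contrapT => noi.
  have fresh i : exists a : T i, forall s, S s -> s i <> a.
    apply: contrapT => H; apply: noi; exists i => a.
    apply: contrapT => H'; apply: H; exists a => s Ss sa.
    by apply: H'; exists s.
  pose t i := projT1 (cid (fresh i)).
  have tP i s : S s -> s i <> t i by rewrite /t; case: cid => /= a + Ss; exact.
  apply: (Smax (S `|` [set t])).
    split; first by move=> s; left.
    by move=> /(_ t) /(_ (or_intror erefl)) /tP /(_ erefl) []; exact: i0.
  move=> i s s' [Ss|->] [Ss'|->] //; first exact: PS.
    by move/tP => /(_ Ss).
  by move/esym/tP => /(_ Ss').
exists i => j; apply/card_le_relP.
exists (fun a b => exists2 s, S s & s i = a /\ s j = b); split.
  by move=> a _; have [s Ss sa] := Si a; exists (s j) => //; exists s.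
by move=> a a' b _ _ [s Ss [<- <-]] [s' Ss' [<- /PS->]].
Qed.

Lemma card_le_total (K L : Type) :
  [set: K] #<= [set: L] \/ [set: L] #<= [set: K].
Proof.
have [[] /= h] := exists_least_card (fun b : bool => if b then K else L) true.
  by left; exact: (h false).
by right; exact: (h true).
Qed.

(** [exists_least_card] needs an indexed family, so it is applied to the
    subsets A of one type K0 with P A; by totality each type L with P L either
    dominates K0 or is equipotent to such a subset. *)
Lemma least_cardinal_exists (P : Type -> Prop) :
  (exists K, P K) ->
  (forall K L : Type, [set: K] #= [set: L] -> P K -> P L) ->
  exists K, least_cardinal P K.
Proof.
move=> [K0 PK0] Peq.
have PT : P (set_type [set: K0]).
  by apply: Peq PK0; rewrite card_eq_sym; exact: card_setT.
pose I := {A : set K0 | P (set_type A)}.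
have [[A PA] Amin] :=
  exists_least_card (fun i : I => set_type (sval i)) (exist _ [set: K0] PT).
exists (set_type A); split=> // L PL.
have [LK|KL] := card_le_total L K0; last first.
  apply: card_le_trans KL; rewrite (card_le_eql (card_setT _)).
  exact: card_leT.
have [r [rt ri]] := (card_le_relP _ _).1 LK.
have /choice[f fr] : forall l, exists b, r l b.
  by move=> l; have [b _ ?] := rt l Logic.I; exists b.
have LE : [set: L] #= [set: set_type (range f)].
  rewrite (card_eqr (card_setT _)) card_eq_sym; apply: inj_card_eq => l l' _ _ E.
  by apply: (ri _ _ (f l)) => //; rewrite E.
rewrite (card_le_eqr LE).
exact: (Amin (exist _ (range f) (Peq _ _ LE PL))).
Qed.

(** A maximal family S of injective sequences with disjoint ranges leaves only
    a finite set R outside these ranges, for an infinite remainder would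
    contain another sequence. The pairs (m, s n) are coded at even places of
    the sequence s, and the countably many pairs with second entry in R at odd
    places of one fixed sequence s0. *)
Lemma card_nat_mul (K : Type) :
  infinite_set [set: K] -> [set: nat * K] #<= [set: K].
Proof.
move=> Kinf.
pose P (S : set (nat -> K)) :=
  forall s t n m, S s -> S t -> s n = t m -> s = t /\ n = m.
have [F FP Ftot|S [PS Smax]] := @Zorn_bigcup _ P.
  move=> s t n m [A FA As] [B FB Bt].
  by have [AB|BA] := Ftot _ _ FA FB; [apply: (FP _ FB)|apply: (FP _ FA)] => //;
    [exact: AB|exact: BA].
pose R := [set k | forall s n, S s -> s n <> k].
have Rfin : finite_set R.
  apply: contrapT => /infiniteP/card_le_relP[r [rt ri]].
  have /choice[t tP] : forall n, exists k, R k /\ r n k.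
    by move=> n; have [//|k] := rt n; exists k.
  apply: (Smax (S `|` [set t])).
    split; first by move=> s; left.
    by move=> /(_ t (or_intror erefl)) St; have [/(_ t 0 St)] := tP 0.
  move=> s s' n m [Ss|->] [Ss'|->]; first exact: PS.
  - by move=> E; have [/(_ s n Ss)] := tP m; rewrite E.
  - by move=> /esym E; have [/(_ s' m Ss')] := tP n; rewrite E.
  - move=> E; split=> //; have [_ rn] := tP n; have [_ rm] := tP m.
    by apply: (ri n m (t n)) => //; rewrite E.
have [s0 Ss0] : exists s, S s.
  apply: contrapT => S0; apply: Kinf; apply: sub_finite_set Rfin => k _ s n Ss.
  by exfalso; apply: S0; exists s.
have /card_le_relP[q [qt qi]] := finite_set_countable Rfin.
apply/card_le_relP.
pose r (x : nat * K) (k : K) :=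
  (exists s n, [/\ S s, s n = x.2 & k = s (pickle (n, x.1)).*2]) \/
  (exists n, [/\ R x.2, q x.2 n & k = s0 (pickle (n, x.1)).*2.+1]).
exists r; split=> [[m k] _|[m k] [m' k'] b _ _].
  have [Rk|] := pselect (R k).
    by have [n _ qn] := qt _ Rk; eexists=> //; right; exists n; split.
  move=> /existsNP[s /existsNP[n /not_implyP[Ss /contrapT sn]]].
  by eexists=> //; left; exists s, n; split.
move=> [[s [n [/= Ss <- ->]]]|[n [/= Rk qk ->]]]
  [[s' [n' [/= Ss' <-]]]|[n' [/= Rk' qk']]].
- by move=> /(PS _ _ _ _ Ss Ss')[<- /double_inj/(pcan_inj pickleK)[<- <-]].
- by move=> /(PS _ _ _ _ Ss Ss0)[_ /(congr1 odd)]; rewrite /= !odd_double.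
- by move=> /(PS _ _ _ _ Ss0 Ss')[_ /(congr1 odd)]; rewrite /= !odd_double.
- move=> /(PS _ _ _ _ Ss0 Ss0)[_ [/double_inj/(pcan_inj pickleK)[nn <-]]].
  by congr pair; apply: (qi _ _ n) => //; rewrite nn.
Qed.

Lemma card_bigcup_le (K T : Type) (D : nat -> set T) :
  infinite_set [set: K] -> (forall n, D n #<= [set: K]) ->
  \bigcup_n D n #<= [set: K].
Proof.
move=> Kinf DK; apply: card_le_trans (card_nat_mul Kinf).
have [r rP] := choice (fun n => (card_le_relP _ _).1 (DK n)).
apply/card_le_relP; exists (fun x nk => D nk.1 x /\ r nk.1 x nk.2); split.
  move=> x [n _ Dx]; have [k _ rk] := (rP n).1 x Dx.
  by exists (n, k).
by move=> x x' [n k] _ _ /= [Dx rx] [Dx' rx']; apply: ((rP n).2 _ _ k).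
Qed.

(** * Continuity on a subspace and locally finite families *)

Lemma bigcup_unpickle (I : countType) (i0 : I) T (F : I -> set T) :
  \bigcup_n F (odflt i0 (unpickle n)) = \bigcup_i F i.
Proof.
apply/seteqP; split=> x [i _ Fx]; first by exists (odflt i0 (unpickle i)).
by exists (pickle i) => //=; rewrite pickleK.
Qed.

Section Within.
Variables X Y : topologicalType.
Implicit Types (f : X -> Y) (A : set X).

Lemma within_openP A f : {within A, continuous f} <->
  forall O, open O -> exists2 G, open G & G `&` A = f @^-1` O `&` A.
Proof.
split=> [/continuousP cf O /cf/open_subspaceP //|H].
by apply/continuousP => O /H oO; apply/open_subspaceP.
Qed.

Lemma within_closedP A f : closed A -> {within A, continuous f} <->
  forall K, closed K -> closed (f @^-1` K `&` A).
Proof.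
move=> cA; split=> [/continuous_closedP cf K /cf|H].
  by move=> /closed_subspaceP[V cV <-]; exact: closedI.
apply/continuous_closedP => K cK; apply/closed_subspaceP.
by exists (f @^-1` K `&` A); [exact: H|rewrite -setIA setIid].
Qed.

End Within.

Section LocallyFinite.
Variable X : topologicalType.
Implicit Types (V : set (set X)) (C : set X -> set X).

(** The sets C B need only lie in the closures of the members B, so that the
    closures themselves are an instance: an open set that meets the closure of
    B meets B. *)
Lemma locally_finite_closed V C : locally_finite V ->
  (forall B, V B -> C B `<=` closure B) -> (forall B, V B -> closed (C B)) ->
  closed (\bigcup_(B in V) C B).
Proof.
move=> lV CB cC; rewrite -openC openE => x xC.
have [W] := lV x; rewrite nbhsE => -[W' [oW' W'x] W'W] fW.
pose S := [set B | V B /\ B `&` W !=set0].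
have cS : closed (\bigcup_(B in S) C B).
  by apply: closed_bigcup => // B [VB _]; exact: cC.
have : nbhs x (W' `&` ~` \bigcup_(B in S) C B).
  apply: filterI; first exact: open_nbhs_nbhs.
  apply: open_nbhs_nbhs; split; first exact: closed_openC.
  by move=> [B [VB _] CBx]; apply: xC; exists B.
apply: filterS => y [W'y Sy] [B VB CBy]; apply: Sy; exists B => //; split=> //.
have [z [Bz /W'W Wz]] := CB B VB y CBy W' (open_nbhs_nbhs (conj oW' W'y)).
by exists z.
Qed.

(** Through closed preimages this is [locally_finite_closed] again. *)
Lemma locally_finite_continuous (Y : topologicalType) (f : X -> Y) V C :
  locally_finite V ->
  (forall B, V B -> C B `<=` closure B) -> (forall B, V B -> closed (C B)) ->
  (forall B, V B -> {within C B, continuous f}) ->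
  {within \bigcup_(B in V) C B, continuous f}.
Proof.
move=> lV CB cC cf; have cU := locally_finite_closed lV CB cC.
apply/(within_closedP f cU) => K cK; rewrite setI_bigcupr.
apply: locally_finite_closed => // B VB; first by move=> x [_ /CB]; exact.
exact: (within_closedP f (cC B VB)).1 (cf B VB) K cK.
Qed.

End LocallyFinite.

(** * Normality of paracompact spaces *)

(** Normality in the form in which it is used to shrink open sets. *)
Definition normal_shrink (X : topologicalType) := forall A O : set X, closed A ->
  open O -> A `<=` O -> exists W, [/\ open W, A `<=` W & closure W `<=` O].

Section Normality.
Variable X : topologicalType.

(** Common core of the two classical steps, from Hausdorff to regular (C a
    point) and from regular to normal (C closed): a locally finite refinement
    turns a separation of each point of A from C into a separation of A. *)
Lemma paracompact_shrink (A C : set X) : paracompact X -> closed A ->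
  (forall a, A a -> exists O, [/\ open O, O a & closure O `&` C = set0]) ->
  exists W, [/\ open W, A `<=` W & closure W `&` C = set0].
Proof.
move=> [_ pX] cA AC.
pose U := [set O | open O /\ (closure O `&` C = set0 \/ O = ~` A)].
have [|V [[oV covV] rV lV]] := pX U.
  split; first by move=> O [].
  apply/seteqP; split=> // x _; have [Ax|nAx] := pselect (A x).
    by have [Q [oO Ox OC]] := AC _ Ax; exists Q => //; split=> //; left.
  by exists (~` A) => //; split; [exact: closed_openC|right].
pose V' := [set B | V B /\ B `&` A !=set0].
have V'V : locally_finite V'.
  move=> x; have [W nW fW] := lV x; exists W => //.
  by apply: sub_finite_set fW => B [[VB _] BW].
have ccl : closed (\bigcup_(B in V') closure B).
  apply: (locally_finite_closed V'V) => B _; [exact: subset_refl|exact: closed_closure].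
exists (\bigcup_(B in V') B); split.
- by apply: bigcup_open => B [/oV].
- move=> a Aa; have [B VB Ba] : (\bigcup_(O in V) O) a by rewrite covV.
  by exists B => //; split=> //; exists a.
- apply/seteqP; split=> // x [Wx Cx].
  have : (\bigcup_(B in V') closure B) x.
    rewrite ((closure_id _).1 ccl).
    apply: closureS Wx => y [B V'B By].
    by exists B => //; exact: subset_closure.
  move=> [B [VB [a [Ba Aa]]] clB]; have [Q [oO [OC|OA]] BO] := rV B VB.
    suff: (closure Q `&` C) x by rewrite OC.
    by split=> //; exact: closureS clB.
  by have := BO _ Ba; rewrite OA.
Qed.

Lemma paracompact_normal : paracompact X -> normal_shrink X.
Proof.
move=> pX A O cA oO AO; have [hX _] := pX.
have cO : closed (~` O) by exact: open_closedC.
have sub W (C : set X) : closure W `&` ~` C = set0 -> closure W `<=` C.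
  by move/disjoints_subset; rewrite setCK.
have [|W [oW AW /sub WO]] := paracompact_shrink (C := ~` O) pX cA; last first.
  by exists W.
move=> a Aa.
(* Regularity, with the roles exchanged: W contains the complement of O and
   its closure misses a. *)
have [|W [oW OW WA]] := paracompact_shrink (C := [set a]) pX cO.
  move=> x Ox; have /eqP xa : a <> x by move=> ax; apply: Ox; rewrite -ax; exact: AO.
  have := hX; rewrite open_hausdorff => /(_ _ _ xa)[[P Q] /= [Pa Qx] [oP oQ PQ]].
  move: Pa Qx; rewrite !inE => Pa Qx; exists Q; split=> //.
  apply/seteqP; split=> // b [clb ba]; rewrite ba in clb.
  have [y [Qy Py]] := clb P (open_nbhs_nbhs (conj oP Pa)).
  suff: (P `&` Q) y by rewrite (eqP PQ).
  by [].
exists (~` closure W); split.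
- by apply: closed_openC; exact: closed_closure.
- move=> Wa; suff: (closure W `&` [set a]) a by rewrite WA.
  by [].
- apply/seteqP; split=> // x [cx Ox].
  have := cx W (open_nbhs_nbhs (conj oW (OW _ Ox))).
  by move=> [y [ny Wy]]; apply: ny; exact: subset_closure.
Qed.

End Normality.

(** * Countable closed decomposition of weakly discontinuous maps *)

Section Pieces.
Variables X Y : topologicalType.
Implicit Types (f : X -> Y) (A G : set X).

Definition sigma_continuous f G :=
  exists2 F : (set X)^nat,
    forall n, closed (F n) /\ {within F n, continuous f} & \bigcup_n F n = G.

Lemma sigma_continuous_count f (I : countType) (F : I -> set X) :
  (forall i, closed (F i) /\ {within F i, continuous f}) ->
  sigma_continuous f (\bigcup_i F i).
Proof.
move=> FP; exists (fun n => if unpickle n is Some i then F i else set0).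
  move=> n; case: unpickle => [i|]; first exact: FP.
  by split; [exact: closed0|exact: continuous_subspace0].
apply/seteqP; split=> x [n _].
  by case: unpickle => // i Fx; exists i.
by move=> Fx; exists (pickle n) => //; rewrite pickleK.
Qed.

Lemma sigma_continuous_bigcup f (K : (set X)^nat) :
  (forall k, sigma_continuous f (K k)) -> sigma_continuous f (\bigcup_k K k).
Proof.
move=> KP.
have /choice[F FP] : forall k, exists F : (set X)^nat,
    (forall n, closed (F n) /\ {within F n, continuous f}) /\ \bigcup_n F n = K k.
  by move=> k; have [F ? ?] := KP k; exists F.
rewrite (_ : \bigcup_k K k = \bigcup_(i : nat * nat) F i.1 i.2).
  by apply: sigma_continuous_count => -[k n]; exact: (FP k).1.
apply/seteqP; split=> [x [k _]|x [[k n] _ Fx]].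
  by rewrite -(FP k).2 => -[n _ Fx]; exists (k, n).
by exists k => //; rewrite -(FP k).2; exists n.
Qed.

(** Being a countable union of closed sets of continuity is preserved by
    arbitrary unions of open sets. The union is an F_sigma, with closed parts K
    k; on a locally finite refinement V of the cover of K k, the n-th closed
    pieces attached to the members of V are glued into one closed set. *)
Lemma sigma_continuous_open_bigcup f (GG : set (set X)) :
  perfectly_paracompact X ->
  (forall G, GG G -> open G /\ sigma_continuous f G) ->
  sigma_continuous f (\bigcup_(G in GG) G).
Proof.
move=> [[_ pX] Fs] GP.
have oGG : open (\bigcup_(G in GG) G) by apply: bigcup_open => G /GP[].
have [K cK GK] := Fs _ oGG; rewrite GK.
apply: sigma_continuous_bigcup => k.
have [|V [[oV covV] rV lV]] := pX (GG `|` [set ~` K k]).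
  split; first by move=> O [/GP[//]|->]; exact: closed_openC.
  apply/seteqP; split=> // x _; have [Kx|nKx] := pselect (K k x).
    have [G GGG Gx] : (\bigcup_(G in GG) G) x by rewrite GK; exists k.
    by exists G => //; left.
  by exists (~` K k) => //; right.
have /choice[C CP] : forall B, exists C : nat * nat -> set X, V B ->
    (forall i, [/\ closed (C i), {within C i, continuous f} & C i `<=` closure B])
    /\ \bigcup_i C i = B `&` K k.
  move=> B; have [VB|] := pselect (V B); last by exists (fun=> set0).
  have [G [GGG|/= ->] BG] := rV B VB; last first.
    exists (fun=> set0) => _; split=> [i|].
      by split; [exact: closed0|exact: continuous_subspace0|].
    by rewrite bigcup0 //; apply/esym/disjoints_subset.
  have [_ [F FP FG]] := GP G GGG.
  have [E cE BE] := Fs B (oV B VB).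
  exists (fun i => F i.1 `&` (E i.2 `&` K k)) => _; split=> [[m n]|] /=.
    have [cF fF] := FP m; split.
    - by apply: closedI => //; apply: closedI.
    - by apply: continuous_subspaceW fF => x [].
    - by move=> x [_ [Ex _]]; apply: subset_closure; rewrite BE; exists n.
  apply/seteqP; split=> [x [[m n] _ [/= Fx [Ex Kx]]]|x [Bx Kx]].
    by split=> //; rewrite BE; exists n.
  have := BG _ Bx; rewrite -FG => -[m _ Fx]; move: Bx; rewrite BE => -[n _ Ex].
  by exists (m, n).
rewrite (_ : K k = \bigcup_i \bigcup_(B in V) (C B i)).
  apply: sigma_continuous_count => i; split.
    apply: locally_finite_closed => // B /CP[CP' _]; by have [] := CP' i.
  apply: locally_finite_continuous => // B /CP[CP' _]; by have [] := CP' i.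
apply/seteqP; split=> [x Kx|x [i _ [B VB Cx]]].
  have [B VB Bx] : (\bigcup_(O in V) O) x by rewrite covV.
  have [_ CB] := CP B VB; have : (B `&` K k) x by [].
  by rewrite -CB => -[i _ Cx]; exists i => //; exists B.
have [_ CB] := CP B VB; suff: (B `&` K k) x by case.
by rewrite -CB; exists i.
Qed.

(** The union G0 of all open sets with the required decomposition has one
    itself; weak discontinuity on the complement of G0 would enlarge it. *)
Lemma weakly_discontinuous_sigma_continuous f :
  perfectly_paracompact X -> weakly_discontinuous f ->
  sigma_continuous f [set: X].
Proof.
move=> pX wf; have [_ Fs] := pX.
pose GG := [set G | open G /\ sigma_continuous f G].
pose G0 := \bigcup_(G in GG) G.
have oG0 : open G0 by apply: bigcup_open => G [].
have sG0 : sigma_continuous f G0 by exact: sigma_continuous_open_bigcup.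
suff -> : [set: X] = G0 by [].
apply/seteqP; split=> // x _; apply: contrapT => G0x.
have [U [[ O oO OU] dU fU]] := wf (~` G0).
(* Density makes U nonempty, since the complement of G0 is. *)
have [u [_ Uu]] : [set: set_type (~` G0)] `&` U !=set0.
  apply: dU; last exact: openT.
  by exists (SigSub (mem_set (G0x : (~` G0) x))).
have UE : set_val @` U = O `&` ~` G0.
  apply/seteqP; split=> [_ [v Uv <-]|y [Oy Gy]].
    by split; [move: Uv; rewrite -OU|exact: set_valP].
  by exists (SigSub (mem_set Gy)) => //; rewrite -OU.
have sU : sigma_continuous f (G0 `|` O).
  rewrite (_ : _ `|` _ = \bigcup_n (if n is 0 then G0 else O `&` ~` G0)).
    apply: sigma_continuous_bigcup => -[//|_].
    have [E cE OE] := Fs O oO; exists (fun n => E n `&` ~` G0).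
      move=> n; split; first by apply: closedI => //; exact: open_closedC.
      apply: continuous_subspaceW fU; rewrite UE => y [Ey Gy]; split=> //.
      by rewrite OE; exists n.
    by rewrite OE setI_bigcupl.
  apply/seteqP; split=> [y [Gy|Oy]|y [[|n] _ //]].
  - by exists 0.
  - by have [Gy|Gy] := pselect (G0 y); [exists 0|exists 1].
  - by left.
  - by move=> []; right.
have : G0 (set_val u).
  exists (G0 `|` O); first by split=> //; exact: openU.
  by right; move: Uu; rewrite -OU.
exact: (set_valP u).
Qed.
End Pieces.

(** * Piecewise homeomorphisms *)

Lemma can2_imageE T U (f : T -> U) (g : U -> T) (A : set T) :
  cancel f g -> cancel g f -> f @` A = g @^-1` A.
Proof.
move=> fK gK; apply/seteqP; split=> [_ [x Ax <-]|y Ay]; first by rewrite /= fK.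
by exists (g y).
Qed.

(** The two spaces are covered by countably many closed pieces F n and f @` F n
    which f and its inverse g identify homeomorphically. *)
Definition sigma_homeo (X Y : topologicalType) (f : X -> Y) (g : Y -> X)
    (F : (set X)^nat) : Prop :=
  [/\ cancel f g, cancel g f, \bigcup_n F n = [set: X],
      forall n, closed (F n) /\ {within F n, continuous f} &
      forall n, closed (f @` F n) /\ {within f @` F n, continuous g}].

Lemma sigma_homeo_sym (X Y : topologicalType) (f : X -> Y) g F :
  sigma_homeo f g F -> sigma_homeo g f (fun n => f @` F n).
Proof.
move=> [fK gK covF cF cfF]; split=> // [|n]; last first.
  rewrite (_ : g @` (f @` F n) = F n); first exact: cF.
  by rewrite image_comp (_ : g \o f = id) ?image_id //; exact/funext.
apply/seteqP; split=> // y _.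
have [n _ Fy] : (\bigcup_n F n) (g y) by rewrite covF.
by exists n => //; exists (g y).
Qed.

(** The pieces are the sets A n `&` f @^-1` B m, for closed covers A of X and B
    of Y on whose members f and g are continuous: they are closed because f is
    continuous on A n, and their images because g is continuous on B m. *)
Lemma weakly_homeomorphic_sigma_homeo (X Y : topologicalType) :
  perfectly_paracompact X -> perfectly_paracompact Y ->
  weakly_homeomorphic X Y -> exists f g F, @sigma_homeo X Y f g F.
Proof.
move=> pX pY [f [g [fK gK wf wg]]].
have [A AP covA] := weakly_discontinuous_sigma_continuous pX wf.
have [B BP covB] := weakly_discontinuous_sigma_continuous pY wg.
pose F (i : nat * nat) := f @^-1` B i.2 `&` A i.1.
have fF i : f @` F i = g @^-1` A i.1 `&` B i.2.
  rewrite (can2_imageE _ fK gK) /F preimage_setI -comp_preimage.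
  by rewrite (_ : f \o g = id) ?preimage_id 1?setIC //; exact/funext.
exists f, g, (fun n => F (odflt (0, 0) (unpickle n))); split=> // [|n|n].
- rewrite bigcup_unpickle; apply/seteqP; split=> // x _.
  have [n _ Ax] : (\bigcup_n A n) x by rewrite covA.
  have [m _ Bx] : (\bigcup_n B n) (f x) by rewrite covB.
  by exists (n, m).
- case: (odflt _ _) => k m; have [cA fA] := AP k; split.
    exact: (within_closedP f cA).1 fA _ (BP m).1.
  by apply: continuous_subspaceW fA => x [].
- rewrite fF; case: (odflt _ _) => k m; have [cB gB] := BP m; split.
    exact: (within_closedP g cB).1 gB _ (AP k).1.
  by apply: continuous_subspaceW gB => x [].
Qed.

Lemma sigma_homeo_open (X Y : topologicalType) (f : X -> Y) g F n (O : set Y) :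
  sigma_homeo f g F -> open O ->
  exists2 G, open G & forall x, F n x -> G x <-> O (f x).
Proof.
move=> [_ _ _ /(_ n)[_ fF] _] oO; have [G oG GE] := (within_openP _ _).1 fF O oO.
exists G => // x Fx; split=> [Gx|Ox].
  by have [] : (f @^-1` O `&` F n) x by rewrite -GE.
by have [] : (G `&` F n) x by rewrite GE.
Qed.

(** * Network weight, hereditary Lindelof number, hereditary density *)

Lemma finite_set_compl_open (X : topologicalType) (S : set X) :
  hausdorff_space X -> finite_set S -> open (~` S).
Proof.
move=> hX fS; apply: closed_openC; apply: compact_closed => //.
exact: finite_compact.
Qed.

(** Separates the finite values of the cardinal invariants, for which no factor
    aleph_0 can be absorbed, from the infinite ones. *)
Lemma finite_subsets_card_dichotomy (T K : Type) :
  (forall S : set T, finite_set S -> S #<= [set: K]) ->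
  [set: T] #<= [set: K] \/ infinite_set [set: K].
Proof.
move=> SK; have [fT|/infiniteP iT] := pselect (finite_set [set: T]).
  by left; exact: SK.
right=> -[n Kn].
have /card_le_relP[r [rt ri]] := iT.
have /choice[t tP] : forall n, exists t, r n t.
  by move=> m; have [//|t] := rt m; exists t.
have ti : injective t.
  by move=> m m' E; apply: (ri m m' (t m)) => //; rewrite E.
have : t @` `I_n.+1 #<= [set: K] by apply: SK; exact: finite_image.
rewrite (card_le_eqr Kn) (card_le_eql (inj_card_eq _)); last by move=> ? ? _ _ /ti.
by rewrite card_le_II ltnn.
Qed.

(** Monotone in K, unlike the condition that defines nw, which asks for a
    network of cardinality exactly K. *)
Definition has_network_card (X : topologicalType) (K : Type) : Prop :=
  exists2 N : set (set X), network N & N #<= [set: K].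

(** Covers are given by neighbourhood assignments x |-> U x: this keeps the
    cover inside X and is stable under transport along f. *)
Definition hereditarily_lindelof (X : topologicalType) (K : Type) : Prop :=
  forall (A : set X) (U : X -> set X), (forall x, A x -> open (U x) /\ U x x) ->
    exists J : set X, [/\ J `<=` A, J #<= [set: K] & A `<=` \bigcup_(x in J) U x].

Definition hereditarily_dense (X : topologicalType) (K : Type) : Prop :=
  forall A : set X, exists2 D : set X,
    D #<= [set: K] & D `<=` A /\ A `<=` closure D.

Section FiniteValues.
Variables (X : topologicalType) (K : Type).
Hypothesis hX : hausdorff_space X.

(** In a Hausdorff space a finite S is discrete, so a network separates its
    points. *)
Lemma network_finite : has_network_card X K ->
  forall S : set X, finite_set S -> S #<= [set: K].
Proof.
move=> [N nN NK] S fS; apply: card_le_trans NK; apply/card_le_relP.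
exists (fun x B => S `&` B = [set x]); split=> [x Sx|x y B _ _ -> E]; last first.
  suff: [set x] y by [].
  by rewrite E.
have oS : open (~` (S `\ x)) by apply: finite_set_compl_open => //; exact: finite_setD.
have [|B NB [Bx BS]] := nN x (~` (S `\ x)).
  by apply: open_nbhs_nbhs; split=> // -[_]; exact.
exists B => //; apply/seteqP; split=> [y [Sy /BS Sxy]|_ ->//].
by apply: contrapT => yx; apply: Sxy.
Qed.

(** The neighbourhoods ~` (S `\ x) meet S in x alone, so a subcover of S needs
    all of them. *)
Lemma lindelof_finite : hereditarily_lindelof X K ->
  forall S : set X, finite_set S -> S #<= [set: K].
Proof.
move=> lX S fS; have [|J [_ JK SJ]] := lX S (fun x => ~` (S `\ x)).
  move=> x Sx; split=> [|[_]]; last exact.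
  by apply: finite_set_compl_open => //; exact: finite_setD.
apply: card_le_trans JK; apply: subset_card_le => x Sx.
have [y Jy Sxy] := SJ x Sx; suff -> : x = y by [].
by apply: contrapT => xy; apply: Sxy.
Qed.

(** A finite subspace of a Hausdorff space is discrete, hence its own only
    dense subset. *)
Lemma dense_finite : hereditarily_dense X K ->
  forall S : set X, finite_set S -> S #<= [set: K].
Proof.
move=> dX S fS; have [D DK [DS SD]] := dX S.
apply: card_le_trans DK; apply: subset_card_le => x Sx.
have [|y [Dy Sxy]] := SD x Sx (~` (S `\ x)).
  apply: open_nbhs_nbhs; split=> [|[_]]; last exact.
  by apply: finite_set_compl_open => //; exact: finite_setD.
have -> // : x = y; apply: contrapT => xy; apply: Sxy; split; first exact: DS.
by move=> /esym.
Qed.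
End FiniteValues.

Section Transfer.
Variables (X Y : topologicalType) (f : X -> Y) (g : Y -> X) (F : (set X)^nat).
Variable K : Type.
Hypothesis (hX : hausdorff_space X) (sF : sigma_homeo f g F).

Let covY y : exists2 n, F n (g y) & f (g y) = y.
Proof.
have [_ gK covF _ _] := sF.
have [n _ Fy] : (\bigcup_n F n) (g y) by rewrite covF.
by exists n; [exact: Fy|exact: gK].
Qed.

Lemma card_small (D : set Y) : [set: X] #<= [set: K] -> D #<= [set: K].
Proof.
apply: card_le_trans; have [fK gK _ _ _] := sF.
exact: card_le_trans (card_leT D) (inj_card_leT (can_inj gK)).
Qed.

(** A network of X is cut to each piece F n and carried to Y. *)
Lemma network_transfer : has_network_card X K -> has_network_card Y K.
Proof.
move=> nX; have [XK|Kinf] := finite_subsets_card_dichotomy (network_finite hX nX).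
  exists (set1 @` [set: Y]).
    by move=> y U nU; exists [set y]; [exists y|split=> // _ ->; exact: nbhs_singleton].
  exact: card_le_trans (card_image_le _ _) (card_small _ XK).
have [N nN NK] := nX.
exists (\bigcup_n ((fun B => f @` (B `&` F n)) @` N)); last first.
  by apply: card_bigcup_le => // n; exact: card_le_trans (card_image_le _ _) NK.
move=> y U; rewrite nbhsE => -[ O [oO Oy] OU].
have [n Fy fgy] := covY y; have [G oG GE] := sigma_homeo_open n sF oO.
have [|B NB [Bx BG]] := nN (g y) G.
  by apply: open_nbhs_nbhs; split=> //; apply/GE => //; rewrite fgy.
exists (f @` (B `&` F n)); first by exists n => //; exists B.
split; first by exists (g y).
by move=> _ [x [Bx' Fx] <-]; apply: OU; apply/GE => //; exact: BG.
Qed.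

(** On the piece F n the cover of A is pulled back to X; the union of the
    subfamilies selected for all n covers A. *)
Lemma lindelof_transfer : hereditarily_lindelof X K -> hereditarily_lindelof Y K.
Proof.
move=> lX; have [XK|Kinf] := finite_subsets_card_dichotomy (lindelof_finite hX lX).
  move=> A U AU; exists A; split=> //; first exact: card_small.
  by move=> y Ay; exists y => //; have [] := AU y Ay.
have [fK gK _ _ _] := sF.
move=> A U AU; pose An n := [set x | A (f x) /\ F n x].
have /choice[J JP] : forall n, exists J : set X, J #<= [set: K] /\
    J `<=` (fun x => A (f x)) /\ forall x, An n x -> exists2 z, J z & U (f z) (f x).
  move=> n.
  have /choice[G GP] : forall z, exists G, A (f z) ->
      open G /\ forall x, F n x -> G x <-> U (f z) (f x).
    move=> z; have [Az|] := pselect (A (f z)); last by exists set0.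
    by have [G oG GE] := sigma_homeo_open n sF (AU _ Az).1; exists G.
  have [|J [JA JK AJ]] := lX (An n) G.
    move=> x [Ax Fx]; have [oG GE] := GP x Ax; split=> //.
    by apply/GE => //; exact: (AU _ Ax).2.
  exists J; split=> //; split=> x; first by move=> /JA[].
  move=> [Ax Fx]; have [z Jz Gz] := AJ x (conj Ax Fx); exists z => //.
  by apply/(GP z _).2 => //; have [] := JA z Jz.
exists (\bigcup_n (f @` J n)); split.
- by move=> y [n _ [x Jx <-]]; have [_ [JA _]] := JP n; exact: JA.
- by apply: card_bigcup_le => // n; exact: card_le_trans (card_image_le _ _) (JP n).1.
move=> y Ay; have [n Fy fgy] := covY y.
have [|z Jz Uz] := (JP n).2.2 (g y); first by split=> //; rewrite fgy.
by exists (f z); [exists n => //; exists z|rewrite -fgy].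
Qed.

(** The dense subset of A is assembled from dense subsets of the traces on X of
    A `&` f @` F n. *)
Lemma dense_transfer : hereditarily_dense X K -> hereditarily_dense Y K.
Proof.
move=> dX; have [XK|Kinf] := finite_subsets_card_dichotomy (dense_finite hX dX).
  move=> A; exists A; first exact: card_small.
  by split=> //; exact: subset_closure.
move=> A; pose An n := [set x | A (f x) /\ F n x].
have /choice[D DP] : forall n, exists D : set X,
    D #<= [set: K] /\ D `<=` An n /\ An n `<=` closure D.
  by move=> n; have [D ? ?] := dX (An n); exists D.
exists (\bigcup_n (f @` D n)).
  by apply: card_bigcup_le => // n; exact: card_le_trans (card_image_le _ _) (DP n).1.
split=> [y [n _ [x Dx <-]]|y Ay U].
  by have [_ [DA _]] := DP n; have [] := DA x Dx.
rewrite nbhsE => -[ O [oO Oy] OU].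
have [n Fy fgy] := covY y; have [G oG GE] := sigma_homeo_open n sF oO.
have [_ [DA AD]] := DP n.
have [||x [Dx Gx]] := AD (g y) _ G; first by split=> //; rewrite fgy.
  by apply: open_nbhs_nbhs; split=> //; apply/GE => //; rewrite fgy.
exists (f x); split; first by exists n => //; exists x.
by apply: OU; apply/GE => //; have [] := DA x Dx.
Qed.
End Transfer.

(** Comparison up to smaller cardinals suffices, by the Cantor-Bernstein
    theorem applied to the least cardinals. *)
Lemma least_cardinal_transfer (P Q : Type -> Prop) :
  (exists K, P K) ->
  (forall K L : Type, [set: K] #= [set: L] -> P K -> P L) ->
  (forall K L : Type, [set: K] #= [set: L] -> Q K -> Q L) ->
  (forall K, P K -> exists2 L, [set: L] #<= [set: K] & Q L) ->
  (forall K, Q K -> exists2 L, [set: L] #<= [set: K] & P L) ->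
  exists K, least_cardinal P K /\ least_cardinal Q K.
Proof.
move=> exP Peq Qeq PQ QP; have [K [PK Kmin]] := least_cardinal_exists exP Peq.
exists K; split=> //; split=> [|L /QP[M ML /Kmin KM]].
  have [L LK QL] := PQ K PK; have [M ML PM] := QP L QL.
  apply: Qeq QL; rewrite card_eq_le LK /=.
  exact: card_le_trans (Kmin M PM) ML.
exact: card_le_trans KM ML.
Qed.

Lemma card_le_eqT (K L T : Type) (D : set T) :
  [set: K] #= [set: L] -> D #<= [set: K] -> D #<= [set: L].
Proof. by move=> KL; rewrite (card_le_eqr KL). Qed.

Lemma nw_le (X : topologicalType) (K : Type) : has_network_card X K ->
  exists2 L : Type, [set: L] #<= [set: K] &
    exists2 N : set (set X), network N & N #= [set: L].
Proof.
move=> [N nN NK]; exists (set_type N); first by rewrite (card_le_eql (card_setT _)).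
by exists N => //; exact: card_setT_sym.
Qed.

Lemma hereditarily_lindelofP (X : topologicalType) (K : Type) :
  hereditarily_lindelof X K <->
  forall (A : set X) (U : set (set A)), open_cover U ->
      exists V : set (set A), [/\ V `<=` U, open_cover V & V #<= [set: K]].
Proof.
split=> [lX A U [oU covU]|lX A U AU].
  have /choice[ O OP] : forall x, exists OG : set A * set X, A x ->
      [/\ U OG.1, open OG.2, OG.2 x & OG.1 = set_val @^-1` OG.2].
    move=> x; have [Ax|] := pselect (A x); last by exists (set0, set0).
    have [P UP Px] : (\bigcup_(P in U) P) (SigSub (mem_set Ax)) by rewrite covU.
    have [G oG GP] := oU P UP; exists (P, G) => _; split=> //=.
    by move: Px; rewrite -GP.
  have [|J [JA JK AJ]] := lX A (fun x => (O x).2); first by move=> x /OP[].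
  exists ((fun x => (O x).1) @` J); split.
  - by move=> _ [x /JA/OP[UO _ _ _] <-].
  - split; first by move=> _ [x /JA/OP[/oU UO _ _ _] <-].
    apply/seteqP; split=> // a _; have [x Jx Ox] := AJ _ (set_valP a).
    exists (O x).1; first by exists x.
    by have [_ _ _ ->] := OP x (JA x Jx).
  - exact: card_le_trans (card_image_le _ _) JK.
pose UU := [set O : set A | exists2 x, A x & O = set_val @^-1` U x].
have [|V [VU [_ covV] VK]] := lX A UU.
  split; first by move=> _ [x /AU[oU _] ->]; exists (U x).
  apply/seteqP; split=> // a _; exists (set_val @^-1` U (set_val a)).
    by exists (set_val a) => //; exact: set_valP.
  by have [] := AU _ (set_valP a).
have /choice[h hP] : forall O : V, exists x, A x /\ set_val O = set_val @^-1` U x.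
  by move=> O; have [x ? ?] := VU _ (set_valP O); exists x.
exists (range h); split.
- by move=> _ [ O _ <-]; have [] := hP O.
- by apply: card_le_trans (card_image_le _ _) _; rewrite (card_le_eql (card_setT _)).
- move=> x Ax; have [P VP Px] : (\bigcup_(P in V) P) (SigSub (mem_set Ax)).
    by rewrite covV.
  have [_ E] := hP (SigSub (mem_set VP)).
  exists (h (SigSub (mem_set VP))); first by exists (SigSub (mem_set VP)).
  suff : (set_val @^-1` U (h (SigSub (mem_set VP)))) (SigSub (mem_set Ax)) by [].
  by rewrite -E.
Qed.

Lemma hereditarily_denseP (X : topologicalType) (K : Type) :
  hereditarily_dense X K <->
  forall A : set X, exists2 D : set A, dense D & D #<= [set: K].
Proof.
split=> dX A; have [D] := dX A.
  move=> DK [DA AD]; exists (set_val @^-1` D).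
    move=> P [a Pa] [ O oO OP]; have Oa : O (set_val a) by move: Pa; rewrite -OP.
    have [x [Dx Ox]] := AD _ (set_valP a) O (open_nbhs_nbhs (conj oO Oa)).
    by exists (SigSub (mem_set (DA x Dx))); split=> //; rewrite -OP.
  apply: card_le_trans DK; apply/card_le_relP.
  exists (fun a x => set_val a = x); split=> [a Da|a a' x _ _ <- /val_inj //].
  by exists (set_val a).
move=> dD DK; exists (set_val @` D); first exact: card_le_trans (card_image_le _ _) DK.
split=> [_ [a _ <-]|x Ax U]; first exact: set_valP.
rewrite nbhsE => -[ O [oO Ox] OU].
have [||a [Oa Da]] := dD (set_val @^-1` O); last first.
- by exists (set_val a); split; [exists a|exact: OU].
- by exists O.
- by exists (SigSub (mem_set Ax)).
Qed.

Section Invariants.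
Variables (X Y : topologicalType) (f : X -> Y) (g : Y -> X) (F : (set X)^nat).
Hypothesis (hX : hausdorff_space X) (hY : hausdorff_space Y) (sF : sigma_homeo f g F).

Lemma nw_sigma_homeo : exists K, is_nw X K /\ is_nw Y K.
Proof.
apply: least_cardinal_transfer.
- exists (set_type [set: set X]); exists setT; last exact: card_setT_sym.
  by move=> x U nU; exists U => //; split=> //; exact: nbhs_singleton.
- by move=> K L KL [N nN NK]; exists N => //; exact: card_eq_trans NK KL.
- by move=> K L KL [N nN NK]; exists N => //; exact: card_eq_trans NK KL.
- move=> K [N nN NK]; apply/nw_le/(network_transfer hX sF); exists N => //.
  by rewrite (card_le_eql NK).
- move=> K [N nN NK]; apply/nw_le/(network_transfer hY (sigma_homeo_sym sF)).
  by exists N => //; rewrite (card_le_eql NK).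
Qed.

Lemma hl_sigma_homeo : exists K, is_hl X K /\ is_hl Y K.
Proof.
apply: least_cardinal_transfer.
- exists X; apply/hereditarily_lindelofP => A U AU; exists A; split=> //.
    exact: card_leT.
  by move=> x Ax; exists x => //; have [] := AU x Ax.
- move=> K L KL lK A U /lK[V [VU cV VK]]; exists V; split=> //.
  exact: card_le_eqT VK.
- move=> K L KL lK A U /lK[V [VU cV VK]]; exists V; split=> //.
  exact: card_le_eqT VK.
- move=> K /hereditarily_lindelofP lK; exists K; first exact: card_lexx.
  by apply/hereditarily_lindelofP; exact: (lindelof_transfer hX sF).
- move=> K /hereditarily_lindelofP lK; exists K; first exact: card_lexx.
  by apply/hereditarily_lindelofP; exact: (lindelof_transfer hY (sigma_homeo_sym sF)).
Qed.

Lemma hd_sigma_homeo : exists K, is_hd X K /\ is_hd Y K.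
Proof.
apply: least_cardinal_transfer.
- exists X; apply/hereditarily_denseP => A; exists A; first exact: card_leT.
  by split=> //; exact: subset_closure.
- by move=> K L KL dK A; have [D dD DK] := dK A; exists D => //; exact: card_le_eqT DK.
- by move=> K L KL dK A; have [D dD DK] := dK A; exists D => //; exact: card_le_eqT DK.
- move=> K /hereditarily_denseP dK; exists K; first exact: card_lexx.
  by apply/hereditarily_denseP; exact: (dense_transfer hX sF).
- move=> K /hereditarily_denseP dK; exists K; first exact: card_lexx.
  by apply/hereditarily_denseP; exact: (dense_transfer hY (sigma_homeo_sym sF)).
Qed.
End Invariants.

(** * Covering dimension *)

(** Covering dimension of the subspace A below n, expressed with open sets of X
    and families indexed by a finite type: order is then the number of indices,
    and the subspace topology stays implicit. *)
Definition dim_lt_on (X : topologicalType) (A : set X) (n : nat) : Prop :=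
  forall (I : finType) (U : I -> set X), (forall i, open (U i)) ->
    A `<=` \bigcup_i U i ->
    exists V : I -> set X, [/\ forall i, open (V i), forall i, V i `<=` U i,
      A `<=` \bigcup_i V i &
      forall x, A x -> (#|[pred i | `[< V i x >]]| <= n)%N].

Lemma card_finType_le (I : finType) (p : pred I) n :
  (#|p| <= n)%N <-> [set i | p i] #<= `I_n.
Proof.
have E : [set i | p i] #= `I_#|p|.
  rewrite card_eq_le; apply/andP; split; apply/card_le_relP.
    exists (fun i k => nth i (enum p) k = i /\ (k < #|p|)%N); split.
      move=> i pi; exists (index i (enum p)).
        by rewrite /= cardE index_mem mem_enum.
      by rewrite nth_index ?mem_enum // cardE index_mem mem_enum.
    move=> i j k _ _ [<- kp] [<- _]; apply: set_nth_default; by rewrite -cardE.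
  exists (fun k i => (k < #|p|)%N /\ nth i (enum p) k = i); split.
    move=> k /= kp; have kp' : (k < size (enum p))%N by rewrite -cardE.
    case E : (enum p) => [|i0 s]; first by rewrite E in kp'.
    exists (nth i0 (enum p) k); last by split=> //; rewrite -E; apply: set_nth_default.
    by rewrite /= -[p _]/(_ \in p) -mem_enum mem_nth.
  move=> k l i kp lp [_ Ek] [_ El]; rewrite /= !cardE in kp lp.
  by apply/eqP; rewrite -(nth_uniq i kp lp (enum_uniq _)) Ek El.
by rewrite (card_le_eql E) card_le_II.
Qed.

(** Passing from a refinement V to a shrinking indexed like the cover U merges
    the members of V that are assigned to the same index, which does not
    increase the order. *)
Lemma covering_dim_ltP (X : topologicalType) n :
  covering_dim_lt X n <-> dim_lt_on [set: X] n.
Proof.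
split=> [dX I U oU covU|dX U fU [oU covU]].
  have [||V [fV [oV covV] rV oV']] := dX (range U).
  - exact/finite_image/finite_finset.
  - split; first by move=> _ [i _ <-].
    apply/seteqP; split=> // x /covU[i _ Uix]; exists (U i) => //; exists i => //.
  pose phi B := [pick i | `[< B `<=` U i >]].
  exists (fun i => \bigcup_(B in [set B | V B /\ phi B = Some i]) B); split.
  - by move=> i; apply: bigcup_open => B [/oV].
  - move=> i x [B [VB]]; rewrite /phi; case: pickP => // j /asboolP BU [<-].
    exact: BU.
  - move=> x _; have [B VB Bx] : (\bigcup_(O in V) O) x by rewrite covV.
    have [_ [i _ <-] BU] := rV B VB.
    case E : (phi B) => [j|]; first by exists j => //; exists B.
    by move: E; rewrite /phi; case: pickP => // /(_ i) /asboolP.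
  - move=> x _; apply/card_finType_le; apply: card_le_trans (oV' x).
    apply/card_le_relP; exists (fun i B => [/\ V B, B x & phi B = Some i]); split.
      by move=> i /= /asboolP[B [VB pB] Bx]; exists B.
    by move=> i j B _ _ [_ _ ->] [_ _ []].
have /finite_seqP[s Us] := fU.
pose u (i : 'I_(size s)) := nth set0 s i.
have uU i : U (u i) by rewrite Us /= mem_nth.
have [||V [oV VU covV Vn]] := dX _ u.
- by move=> i; exact: oU.
- move=> x _; have [B] : (\bigcup_(O in U) O) x by rewrite covU.
  rewrite {1}Us /= => Bs Bx; have Bi : (index B s < size s)%N by rewrite index_mem.
  by exists (Ordinal Bi) => //; rewrite /u /= nth_index.
exists (range V); split.
- exact/finite_image/finite_finset.
- split; first by move=> _ [i _ <-].
  by apply/seteqP; split=> // x /covV[i _ Vix]; exists (V i) => //; exists i.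
- by move=> _ [i _ <-]; exists (u i).
- move=> x; apply: card_le_trans ((card_finType_le _ _).1 (Vn x Logic.I)).
  apply/card_le_relP; exists (fun B i => V i = B); split.
    by move=> _ [[i _ <-] Vx]; exists i => //; apply/asboolP.
  by move=> B B' i _ _ -> ->.
Qed.

Lemma finite_bigcap_open (X : topologicalType) (I : finType) (P : I -> Prop)
    (U : I -> set X) :
  (forall i, open (U i)) -> open (\bigcap_(i in [set i | P i]) U i).
Proof.
move=> oU; rewrite -closedC setC_bigcap; apply: closed_bigcup.
  exact: finite_finset.
by move=> i _; exact: open_closedC.
Qed.

(** The members of the cover are replaced one at a time: the part of X covered
    by W i alone is closed and lies in W i. *)
Lemma finite_cover_shrink (X : topologicalType) (I : finType) (U : I -> set X) :
  normal_shrink X -> (forall i, open (U i)) -> \bigcup_i U i = setT ->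
  exists W : I -> set X, [/\ forall i, open (W i), \bigcup_i W i = setT &
    forall i, closure (W i) `<=` U i].
Proof.
move=> nX oU covU.
suff [W [oW covW _ WU]] : exists W : I -> set X, [/\ forall i, open (W i),
    \bigcup_i W i = setT, forall i, W i `<=` U i &
    forall i, i \in enum I -> closure (W i) `<=` U i].
  by exists W; split=> // i; apply: WU; rewrite mem_enum.
elim: (enum I) => [|i s [W [oW covW WU sU]]].
  by exists U; split=> // i; exact: subset_refl.
have oN : open (\bigcup_(j in [set j | j != i]) W j) by exact: bigcup_open.
have [|||O [oO NO OW]] := nX (~` \bigcup_(j in [set j | j != i]) W j) (W i).
- exact: open_closedC.
- exact: oW.
- move=> x Nx; have [j _ Wj] : (\bigcup_i W i) x by rewrite covW.
  have [<-//|ji] := eqVneq j i.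
  by exfalso; apply: Nx; exists j.
have OW' : O `<=` W i by move=> x Ox; apply: OW; exact: subset_closure.
exists (fun j => if j == i then O else W j); split.
- by move=> j; case: ifP.
- apply/seteqP; split=> // x _.
  have [[j /= ji Wj]|Nx] := pselect ((\bigcup_(j in [set j | j != i]) W j) x).
    by exists j => //; rewrite (negbTE ji).
  by exists i => //; rewrite eqxx; exact: NO.
- by move=> j; case: eqP => [->|_]; [exact: subset_trans OW' (WU i)|exact: WU].
- move=> j; rewrite inE; case: eqP => [-> _|_ /= /sU //].
  exact: subset_trans OW (WU i).
Qed.

Section DimSum.
Variable (X : topologicalType).
Hypothesis nX : normal_shrink X.

(** The complement of A, at index None, completes a cover of A to one of X. *)
Lemma dim_lt_on_closed (A : set X) n : dim_lt_on [set: X] n -> closed A -> dim_lt_on A n.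
Proof.
move=> dX cA I U oU covU.
have [||V [oV VU covV Vn]] := dX (option I) (fun o => if o is Some i then U i else ~` A).
- by case=> [i|]; [exact: oU|exact: closed_openC].
- move=> x _; have [Ax|nAx] := pselect (A x); last by exists None.
  by have [i _ Ui] := covU x Ax; exists (Some i).
exists (fun i => V (Some i)); split=> //.
- by move=> x Ax; have [[i|] _ Vx] := covV x Logic.I; [exists i|have := VU None x Vx].
- move=> x Ax; apply: leq_trans (Vn x Logic.I).
  have Sinj : injective (@Some I) by move=> i j [].
  rewrite -(fintype.card_image Sinj); apply: subset_leq_card.
  by apply/fintype.subsetP => o /fintype.imageP[i /asboolP Vx ->]; apply/asboolP.
Qed.

(** One step of the countable sum theorem: outside A the cover U is kept,
    inside A it is replaced by a shrinking of small order, and the result is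
    shrunk again so that the order on A is that of closures. *)
Lemma dim_step (A : set X) n (I : finType) (U : I -> set X) :
  closed A -> dim_lt_on A n ->
  (forall i, open (U i)) -> \bigcup_i U i = setT ->
  exists W : I -> set X, [/\ forall i, open (W i), \bigcup_i W i = setT,
    forall i, closure (W i) `<=` U i &
    forall x, A x -> (#|[pred i | `[< closure (W i) x >]]| <= n)%N].
Proof.
move=> cA dA oU covU; have [|V [oV VU covV Vn]] := dA I U oU; first by rewrite covU.
have [||W [oW covW WV]] :=
  finite_cover_shrink (U := fun i => (U i `&` ~` A) `|` V i) nX.
- move=> i; apply: openU; [apply: openI|]; [exact: oU|exact: closed_openC|exact: oV].
- apply/seteqP; split=> // x _; have [/covV[i _ Vx]|nAx] := pselect (A x).
    by exists i => //; right.
  have [i _ Ux] : (\bigcup_i U i) x by rewrite covU.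
  by exists i => //; left.
exists W; split=> //.
  by move=> i x /WV[[]//|/VU].
move=> x Ax; apply: leq_trans (Vn x Ax); apply: subset_leq_card.
by apply/fintype.subsetP => i /asboolP /WV[[]//|Vx]; apply/asboolP.
Qed.

(** Closed sets swell to open sets of the same order. For each set S of more
    than n indices the complements of the C i, i in S, cover X; this cover has
    a shrinking D S with closures still inside the complements, and W i is U i
    minus the closures of D S i for all large S containing i. A point in all W
    i, i in S, would be in no D S i. *)
Lemma closed_order_swelling n (I : finType) (U C : I -> set X) :
  (forall i, open (U i)) -> (forall i, closed (C i)) -> (forall i, C i `<=` U i) ->
  (forall x, (#|[pred i | `[< C i x >]]| <= n)%N) ->
  exists W : I -> set X, [/\ forall i, open (W i), forall i, C i `<=` W i,
    forall i, W i `<=` U i & forall x, (#|[pred i | `[< W i x >]]| <= n)%N].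
Proof.
move=> oU cC CU Cn.
have /choice[D DP] : forall S : {set I}, exists D : I -> set X, (n < #|S|)%N ->
    [/\ \bigcup_i D i = setT, forall i, i \in S -> closure (D i) `<=` ~` C i &
      forall i, i \notin S -> D i = set0].
  move=> S; have [nS|] := boolP (n < #|S|)%N; last by exists (fun=> set0).
  have [||W [oW covW WV]] :=
    finite_cover_shrink (U := fun i => if i \in S then ~` C i else set0) nX.
  - by move=> i; case: ifP => _; [exact: closed_openC|exact: open0].
  - apply/seteqP; split=> // x _; apply: contrapT => nx.
    suff /(leq_trans nS) : (#|S| <= n)%N by rewrite ltnn.
    apply: leq_trans (Cn x); apply: subset_leq_card; apply/fintype.subsetP => i iS.
    apply/asboolP; apply: contrapT => Cx; apply: nx; exists i => //.
    by rewrite iS.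
  exists W => _; split=> // i iS; first by have := WV i; rewrite iS.
  apply/seteqP; split=> // x /subset_closure /WV; by rewrite (negbTE iS).
(* Finitely many closures are removed from U i, so the result is open. *)
pose big (i : I) (S : {set I}) := (n < #|S|)%N /\ i \in S.
exists (fun i => U i `&` \bigcap_(S in [set S | big i S]) ~` closure (D S i)); split.
- move=> i; apply: openI => //; apply: finite_bigcap_open => S.
  by apply: closed_openC; exact: closed_closure.
- move=> i x Cx; split; first exact: CU.
  by move=> S [nS iS]; have [_ /(_ i iS) H _] := DP S nS => /H.
- by move=> i x [].
- move=> x; rewrite leqNgt; apply/negP.
  set p := [pred i | _] => np; pose S := [set i in p]%SET.
  have nS : (n < #|S|)%N by rewrite cardsE.
  have [covD _ D0] := DP S nS.
  have [i _ Dx] : (\bigcup_i D S i) x by rewrite covD.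
  have [iS|/D0 D0i] := boolP (i \in S); last by rewrite D0i in Dx.
  have := iS; rewrite inE => /asboolP[_ /(_ S)]; apply; first by [].
  exact: subset_closure.
Qed.

(** Countable closed sum theorem. Applying [dim_step] to F 0, F 1, ... in turn
    gives covers Us k with closures of Us k.+1 inside Us k; the closed sets C
    i, intersections of the Us k i, have order at most n on every F k and still
    cover X since there are finitely many indices i. *)
Lemma dim_countable_sum n (F : (set X)^nat) :
  (forall k, closed (F k)) -> \bigcup_k F k = setT ->
  (forall k, dim_lt_on (F k) n) -> dim_lt_on [set: X] n.
Proof.
move=> cF covF dF I U oU covU.
have {}covU : \bigcup_i U i = setT by apply/seteqP; split.
pose cover (W : I -> set X) := (forall i, open (W i)) /\ \bigcup_i W i = setT.
have /choice[st stP] : forall kW : nat * (I -> set X), exists W' : I -> set X,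
    cover kW.2 -> [/\ cover W', forall i, closure (W' i) `<=` kW.2 i &
      forall x, F kW.1 x -> (#|[pred i | `[< closure (W' i) x >]]| <= n)%N].
  move=> [k W] /=; have [[oW covW]|] := pselect (cover W); last by exists W.
  have [W' [oW' covW' W'W W'n]] := dim_step (cF k) (dF k) oW covW.
  by exists W'.
pose fix Us k := if k is k'.+1 then st (k', Us k') else U.
have Uc k : cover (Us k).
  by elim: k => [//|k IH]; have [] := stP (k, Us k) IH.
have UsP k := stP (k, Us k) (Uc k).
have Udec k i : closure (Us k.+1 i) `<=` Us k i by have [_ H _] := UsP k; exact: H.
have Ule k l i : (k <= l)%N -> Us l i `<=` Us k i.
  elim: l => [|l IH]; first by rewrite leqn0 => /eqP ->.
  rewrite leq_eqVlt => /predU1P[<-//|/IH kl] x Ux.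
  by apply: kl; apply: Udec; exact: subset_closure.
pose C i := \bigcap_k closure (Us k.+1 i).
have [||x|W [oW CW WU Wn]] := @closed_order_swelling n I U C oU.
- by move=> i; apply: closed_bigI => k _; exact: closed_closure.
- by move=> i x Cx; apply: (Udec 0); exact: Cx.
- have [k _ Fx] : (\bigcup_k F k) x by rewrite covF.
  have [_ _ /(_ x Fx)] := UsP k; apply: leq_trans; apply: subset_leq_card.
  by apply/fintype.subsetP => i /asboolP Cx; apply/asboolP; exact: Cx.
exists W; split=> // x _.
suff [i Ci] : exists i, C i x by exists i => //; exact: CW.
(* If x left each C i at stage k i, stage \max_j k j would not cover x. *)
apply: contrapT => nC.
have /choice[k kP] : forall i, exists k, ~ Us k i x.
  move=> i; apply: contrapT => nk; apply: nC; exists i => k _.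
  by apply: subset_closure; apply: contrapT => nU; apply: nk; exists k.+1.
have [i _ Ux] : (\bigcup_i Us (\max_j k j) i) x by rewrite (Uc _).2.
by apply: (kP i); apply: Ule Ux; exact: leq_bigmax.
Qed.
End DimSum.

Section DimTransfer.
Variables (X Y : topologicalType) (f : X -> Y) (g : Y -> X) (F : (set X)^nat).
Hypothesis (sF : sigma_homeo f g F).

Lemma dim_lt_on_image n k : dim_lt_on (F k) n -> dim_lt_on (f @` F k) n.
Proof.
move=> dF I U oU covU; have [fK gK _ _ _] := sF.
have /choice[G GP] : forall i, exists G, open G /\
    forall x, F k x -> G x <-> U i (f x).
  by move=> i; have [G ? ?] := sigma_homeo_open k sF (oU i); exists G.
have [||V [oV VG covV Vn]] := dF I G.
- by move=> i; have [] := GP i.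
- move=> x Fx; have [i _ Ui] := covU (f x) (imageP f Fx).
  by exists i => //; apply/(GP i).2.
have /choice[H HP] : forall i, exists H, open H /\
    forall y, (f @` F k) y -> H y <-> V i (g y).
  by move=> i; have [H ? ?] := sigma_homeo_open k (sigma_homeo_sym sF) (oV i); exists H.
exists (fun i => H i `&` U i); split.
- by move=> i; apply: openI => //; have [] := HP i.
- by move=> i y [].
- move=> _ [x Fx <-]; have [i _ Vx] := covV x Fx; exists i => //; split.
    by apply/(HP i).2; [exists x|rewrite fK].
  by apply/(GP i).2 => //; exact: VG.
- move=> _ [x Fx <-]; apply: leq_trans (Vn x Fx); apply: subset_leq_card.
  apply/fintype.subsetP => i /asboolP[Hx _]; apply/asboolP; rewrite -(fK x).
  by apply/(HP i).2 => //; exists x.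
Qed.

Lemma covering_dim_lt_transfer n : normal_shrink Y ->
  covering_dim_lt X n -> covering_dim_lt Y n.
Proof.
move=> nY /covering_dim_ltP dX; apply/covering_dim_ltP.
have [_ _ covF _ _] := sigma_homeo_sym sF; have [_ _ _ cF cfF] := sF.
apply: (dim_countable_sum nY (F := fun k => f @` F k)) => // k.
  exact: (cfF k).1.
by apply: dim_lt_on_image; apply: dim_lt_on_closed => //; exact: (cF k).1.
Qed.
End DimTransfer.

Lemma covering_dim_sigma_homeo (X Y : topologicalType) (f : X -> Y) g F :
  normal_shrink X -> normal_shrink Y -> sigma_homeo f g F ->
  covering_dim X = covering_dim Y.
Proof.
move=> nX nY sF; rewrite /covering_dim (_ : covering_dim_lt X = covering_dim_lt Y) //.
apply/funext => n; apply/propext; split.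
  exact: (covering_dim_lt_transfer sF).
exact: (covering_dim_lt_transfer (sigma_homeo_sym sF)).
Qed.

(** * Polish spaces *)

Local Open Scope ring_scope.

Section EmbeddedMetric.
Variables (R : realType) (S : choiceType) (M : metricType R) (h : S -> M).

(** The metric of M pulled back along an injection; it induces the initial
    topology of h. *)
Definition embedded_metric (hI : injective h) : Type := initial_topology h.

Variable hI : injective h.
HB.instance Definition _ :=
  PseudoMetric.copy (embedded_metric hI) (initial_topology h).

Let dist (x y : embedded_metric hI) : R := mdist (h x) (h y).

Let dist_ge0 x y : 0 <= dist x y. Proof. exact: mdist_ge0. Qed.

Let dist_positivity x y : dist x y = 0 -> x = y.
Proof. by move=> /mdist_positivity /hI. Qed.

Let ball_dist x d : ball x d = [set y | dist x y < d].
Proof. by rewrite -initial_ballE ballEmdist. Qed.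

HB.instance Definition _ := PseudoMetric_isMetric.Build R (embedded_metric hI)
  dist_ge0 dist_positivity ball_dist.
End EmbeddedMetric.

Section LayeredMetric.
Variables (R : realType) (M : metricType R).

(** Countably many disjoint copies of T, points of different copies being at
    distance at least 1. *)
Definition layered (T : metricType R) : Type := nat * T.
HB.instance Definition _ := Choice.copy (layered M) (nat * M)%type.

Let dist (x y : layered M) : R := (x.1 != y.1)%:R + mdist x.2 y.2.

Let distxx x : dist x x = 0. Proof. by rewrite /dist eqxx mdistxx addr0. Qed.

Let dist_positivity x y : dist x y = 0 -> x = y.
Proof.
case: x y => [n x] [m y] /eqP; rewrite /dist paddr_eq0 ?mdist_ge0 ?ler0n //=.
by rewrite pnatr_eq0 eqb0 negbK => /andP[/eqP -> /eqP/mdist_positivity ->].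
Qed.

Let dist_sym x y : dist x y = dist y x.
Proof. by rewrite /dist eq_sym metric_sym. Qed.

Let dist_triangle y x z : dist x z <= dist x y + dist y z.
Proof.
rewrite /dist addrACA lerD ?metric_triangle // -natrD ler_nat.
by have [<-|xy] := eqVneq x.1 y.1; [|case: (_ != _)].
Qed.

HB.instance Definition _ := isMetric.Build R (layered M)
  distxx dist_positivity dist_sym dist_triangle.

Lemma layered_ball (n : nat) (x y : M) (e : R) :
  ball x e y -> ball ((n, x) : layered M) e ((n, y) : layered M).
Proof. by rewrite !ballEmdist /= /mdist /= /dist eqxx add0r. Qed.

Lemma layered_ball1 (x y : layered M) (e : R) : e <= 1 ->
  ball x e y -> x.1 = y.1 /\ ball x.2 e y.2.
Proof.
move=> e1; rewrite !ballEmdist /= {1}/mdist /= /dist.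
have [-> |_] := eqVneq; first by rewrite add0r.
by rewrite ltNge (le_trans e1) // lerDl mdist_ge0.
Qed.

Lemma layered_open (A : set (layered M)) :
  (forall n, open [set x : M | A (n, x)]) -> open A.
Proof.
move=> oA; rewrite openE => -[n x] Ax.
have /nbhs_ballP[e /= e0 eA] := open_nbhs_nbhs (conj (oA n) Ax).
apply/nbhs_ballP; exists (Num.min e 1); first by rewrite /= lt_min e0 ltr01.
have e1 : Num.min e 1 <= 1 by rewrite ge_min lexx orbT.
move=> [m y] /(layered_ball1 e1)[/= <- xy].
by apply: eA; apply: le_ball xy; rewrite ge_min lexx.
Qed.

Lemma layered_complete : complete_metric M -> complete_metric (layered M).
Proof.
move=> cM G PG /cauchyP cG.
have e1 (e : R) : Num.min e 1 <= 1 by rewrite ge_min lexx orbT.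
have [[n x0] G1] := cG 1 ltr01.
have : cauchy ((snd : layered M -> M) @ G).
  apply/cauchy_exP => e e0.
  have [|z Gz] := cG (Num.min e 1); first by rewrite lt_min e0 ltr01.
  exists z.2; have : G ((snd : layered M -> M) @^-1` ball z.2 e); last by [].
  apply: filterS Gz => y /(layered_ball1 (e1 e))[_].
  by apply: le_ball; rewrite ge_min lexx.
move=> /cM [x Gx].
exists (n, x) => A /nbhs_ballP[e /= e0 eA].
have Gy : G (snd @^-1` ball x e) by apply: Gx; exact: nbhsx_ballx.
apply: filterS (filterI G1 Gy) => -[m y] [/(layered_ball1 (lexx 1))[/= <- _] xy].
by apply: eA; exact: layered_ball.
Qed.
End LayeredMetric.

(** A map h into a separable metric space has separable initial topology: for
    each dense point d and each k choose, if possible, one point whose image is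
    within 1 / k.+1 of d. *)
Lemma separable_sub (R : realType) (M : pseudoMetricType R) (S : choiceType)
    (h : S -> M) :
  separable M -> separable (initial_topology h).
Proof.
move=> [D cD dD].
pose pick (i : M * nat) : option S :=
  match pselect (exists s, ball i.1 i.2.+1%:R^-1 (h s)) with
  | left p => Some (projT1 (cid p))
  | right _ => None
  end.
exists (\bigcup_(i in D `*` [set: nat]) [set s | pick i = Some s]).
  apply: bigcup_countable => [|i _]; first exact: countableX.
  case: (pick i) => [s|]; last first.
    by rewrite (_ : [set _ | _] = set0) //; apply/seteqP; split.
  by apply: sub_countable (countable1 s); apply: subset_card_le => t [->].
move=> P [s Ps] [ O oO OP].
have /nbhs_ballP[e /= e0 eO] : nbhs (h s) O.
  by apply: open_nbhs_nbhs; split=> //; move: Ps; rewrite -OP.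
have [k ke] : exists k, k.+1%:R^-1 < e / 2.
  have := near_infty_natSinv_lt (PosNum (divr_gt0 e0 (ltr0n R 2))).
  by case=> N _ /(_ N (leqnn N)); exists N.
pose r : R := k.+1%:R^-1; have r0 : 0 < r by rewrite invr_gt0 ltr0n.
have [||d [sd Dd]] := dD (ball (h s) r)^°.
- by exists (h s); exact: nbhsx_ballx.
- exact: open_interior.
have {sd}sd : ball (h s) r d by exact: interior_subset.
have E : exists t, pick (d, k) = Some t /\ ball d r (h t).
  rewrite /pick; case: pselect => [p|[]]; last by exists s; exact: ball_sym.
  by exists (projT1 (cid p)); split=> //; case: (cid p).
have [t [dt bt]] := E.
exists t; split; last by exists (d, k).
rewrite -OP; apply: eO; apply: (ball_split (z := d)).
  by apply: le_ball sd; exact: ltW.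
by apply: le_ball bt; exact: ltW.
Qed.

Lemma separable_image (X Y : topologicalType) (f : X -> Y) :
  continuous f -> range f = setT -> separable X -> separable Y.
Proof.
move=> /continuousP cf rf [D cD dD]; exists (f @` D).
  by apply: sub_countable cD; exact: card_image_le.
move=> O [y Oy] oO; have [|x [Ox Dx]] := dD (f @^-1` O) _ (cf _ oO).
  have [x _ xy] : range f y by rewrite rf.
  by exists x; rewrite /= xy.
by exists (f x); split=> //; exists x.
Qed.

Lemma polish_metric (R : realType) (X : topologicalType) : polish R X ->
  exists (M : metricType R) (p : M -> X) (q : X -> M),
    [/\ separable M, complete_metric M, cancel p q, cancel q p &
       continuous p /\ continuous q].
Proof.
move=> [sX [M [cM [p [q [pK qK cp cq]]]]]]; exists M, p, q; split=> //.
apply: (separable_image cq) => //; apply/seteqP; split=> // x _.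
by exists (p x).
Qed.

(** A Cauchy filter on W is mapped to a convergent one, whose limit lies in the
    closed range of e. *)
Lemma polish_closed_embedding (R : realType) (Z W : topologicalType) (e : W -> Z) :
  polish R Z -> injective e -> continuous e ->
  (forall O, open O -> exists2 G, open G & O = e @^-1` G) -> closed (range e) ->
  polish R W.
Proof.
move=> /polish_metric[M [p [q [sM cM pK qK [cp cq]]]]] eI /continuousP ce oe cle.
pose h w := q (e w); have hI : injective h by apply: inj_comp eI; exact: can_inj qK.
pose N : metricType R := embedded_metric hI.
have oN (O : set W) : open (O : set N) <-> open O.
  split=> [[G oG <-]|/oe[G oG ->]].
    by have := ce _ ((continuousP _).1 cq _ oG).
  exists (p @^-1` G); first exact: ((continuousP _).1 cp).
  by rewrite /h; apply/seteqP; split=> w /=; rewrite qK.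
have ci : continuous (id : N -> W) by apply/continuousP => O oO; exact/oN.
have cj : continuous (id : W -> N) by apply/continuousP => O oO; exact/oN.
split.
  apply: (separable_image ci); first by rewrite image_id.
  exact: (separable_sub h sM).
exists N; split; last by exists id, id.
move=> G PG /cauchyP cG.
have [|m Gm] := cM (h @ G) _.
  by apply/cauchy_exP => r r0; have [w Gw] := cG r r0; exists (h w).
have [w _ wm] : range h m.
  have clh : closed (range h).
    rewrite (_ : range h = p @^-1` range e).
      by move/continuous_closedP : cp; exact.
    apply/seteqP; split=> [_ [w _ <-]|x [w _ ew]].
      by exists w => //; rewrite /h qK.
    by exists w => //; rewrite /h ew pK.
  apply: clh => B /Gm GB.
  have [w Bw] : exists w, (h @^-1` B) w by exact: (@filter_ex _ G).
  by exists (h w); split=> //; exists w.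
exists w => A /nbhs_ballP[r /= r0 rA].
have : G (h @^-1` ball (h w) r) by apply: Gm; rewrite -wm; exact: nbhsx_ballx.
by apply: filterS => x xr; apply: rA.
Qed.

Lemma polish_layered (R : realType) (M : metricType R) :
  separable M -> complete_metric M -> polish R (layered M).
Proof.
move=> [D cD dD] cM; split.
  exists [set z | D z.2].
    apply: sub_countable (countableX (countableP [set: nat]) cD).
    by apply: subset_card_le => -[].
  move=> O [[n x] Ox] oO.
  have /nbhs_ballP[e /= e0 eO] := open_nbhs_nbhs (conj oO Ox).
  have [||y [xy Dy]] := dD (ball x e)^°.
  - by exists x; exact: nbhsx_ballx.
  - exact: open_interior.
  by exists (n, y); split=> //; apply: eO; apply: layered_ball; exact: interior_subset.
exists (layered M); split; first exact: layered_complete.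
by exists id, id; split=> // x; exact: cvg_id.
Qed.

(** * Transfer of analyticity, sigma-compactness and sigma-Polishness *)

Lemma set_val_closed (X : topologicalType) (A : set X) :
  closed A -> closed (range (set_val : A -> X)).
Proof.
rewrite (_ : range _ = A) //; apply/seteqP; split=> [_ [a _ <-]|x Ax].
  exact: set_valP.
by exists (SigSub (mem_set Ax)).
Qed.

Section Transfer.
Variables (R : realType).
Variables (X Y : topologicalType) (f : X -> Y) (g : Y -> X) (F : (set X)^nat).
Hypothesis (sF : sigma_homeo f g F).

(** If r maps the Polish space P onto X, then the pairs (n, t) with r t in F n
    form a closed subset of countably many disjoint copies of P, and (n, t) |->
    f (r t) maps it onto Y; this map is continuous because each layer is open
    and f is continuous on F n. *)
Lemma analytic_transfer : analytic R X -> analytic R Y.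
Proof.
move=> [P [r [polP /continuousP cr rr]]].
have [M [p [q [sM cM pK qK [/continuousP cp _]]]]] := polish_metric polP.
have [fK gK covF cF _] := sF.
pose C := [set z : layered M | F z.1 (r (p z.2))].
have cC : closed C.
  rewrite -openC; apply: layered_open => n.
  rewrite (_ : [set _ | _] = p @^-1` (r @^-1` ~` F n)) //.
  by apply/cp/cr/closed_openC; have [] := cF n.
exists C, (fun z => f (r (p (set_val z).2))); split.
- apply: (polish_closed_embedding (polish_layered sM cM) (e := set_val)).
  + exact: val_inj.
  + exact: initial_continuous.
  + by move=> _ [G oG <-]; exists G.
  + exact: set_val_closed.
- apply/continuousP => O oO.
  have /choice[G GP] : forall n, exists G, open G /\ forall x, F n x -> G x <-> O (f x).
    by move=> n; have [G ? ?] := sigma_homeo_open n sF oO; exists G.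
  exists [set z : layered M | G z.1 (r (p z.2))].
    by apply: layered_open => n; exact: (cp _ (cr _ (GP n).1)).
  apply/seteqP; split=> z; have [_ /(_ _ (set_valP z))H] := GP (set_val z).1.
    exact: H.1.
  exact: H.2.
- apply/seteqP; split=> // y _.
  have [n _ Fy] : (\bigcup_n F n) (g y) by rewrite covF.
  have [t _ rt] : range r (g y) by rewrite rr.
  have Cz : C (n, q t) by rewrite /C /= qK rt.
  by exists (SigSub (mem_set Cz)) => //=; rewrite /= qK rt gK.
Qed.

Lemma sigma_compact_transfer : sigma_compact X -> sigma_compact Y.
Proof.
move=> [K cK covK]; have [fK gK covF cF _] := sF.
pose L (i : nat * nat) := f @` (K i.1 `&` F i.2).
exists (fun n => L (odflt (0, 0)%N (unpickle n))).
  move=> n; case: (odflt _ _) => k m; have [cFm fF] := cF m; apply: continuous_compact.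
    by apply: continuous_subspaceW fF => x [].
  exact: compact_closedI.
rewrite bigcup_unpickle; apply/seteqP; split=> // y _.
have [k _ Ky] : (\bigcup_n K n) (g y) by rewrite covK.
have [n _ Fy] : (\bigcup_n F n) (g y) by rewrite covF.
by exists (k, n) => //; exists (g y).
Qed.

(** The traces on the pieces of the closed Polish cover of X are carried to Y;
    g embeds each image as a closed subspace of a member of the cover. *)
Lemma sigma_polish_transfer : sigma_polish R X -> sigma_polish R Y.
Proof.
move=> [K cK covK]; have [fK gK covF cF cfF] := sF.
pose L (i : nat * nat) := f @` (K i.1 `&` F i.2).
exists (fun n => L (odflt (0, 0)%N (unpickle n))); last first.
  rewrite bigcup_unpickle; apply/seteqP; split=> // y _.
  have [k _ Ky] : (\bigcup_n K n) (g y) by rewrite covK.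
  have [n _ Fy] : (\bigcup_n F n) (g y) by rewrite covF.
  by exists (k, n) => //; exists (g y).
move=> n; case: (odflt _ _) => {n} k n.
have [cKk pKk] := cK k; have [cFn fF] := cF n; have [cfFn gF] := cfF n.
split.
  rewrite (_ : L _ = g @^-1` K k `&` f @` F n).
    exact: (within_closedP g cfFn).1.
  by rewrite /L !(can2_imageE _ fK gK).
have gL (y : L (k, n)) : K k (g (set_val y)).
  by have [x [Kx _] fx] := set_valP y; move: Kx; rewrite -{1}(fK x) fx.
have gF' (y : L (k, n)) : F n (g (set_val y)).
  by have [x [_ Fx] fx] := set_valP y; move: Fx; rewrite -{1}(fK x) fx.
pose e (y : L (k, n)) : K k := SigSub (mem_set (gL y)).
apply: (polish_closed_embedding pKk (e := e)).
- by move=> y y' /(congr1 set_val) /= /(can_inj gK) /val_inj.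
- apply/continuousP => _ [ O oO <-].
  have [G oG GE] := sigma_homeo_open n (sigma_homeo_sym sF) oO.
  exists G => //; apply/seteqP; split=> y /= H.
    apply/GE => //; exists (g (set_val y)); [exact: gF'|exact: gK].
  apply/GE => //; exists (g (set_val y)); [exact: gF'|exact: gK].
- move=> _ [ O oO <-]; have [G oG GE] := sigma_homeo_open n sF oO.
  exists (set_val @^-1` G); first by exists G.
  apply/seteqP; split=> y /= H.
    by apply/(GE _ (gF' y)); rewrite gK.
  by move: H => /(GE _ (gF' y)); rewrite gK.
- rewrite (_ : range e = set_val @^-1` F n).
    by move: (@initial_continuous (K k) X set_val) => /continuous_closedP; exact.
  apply/seteqP; split=> [_ [y _ <-]|x /= Fx]; first exact: gF'.
  have Lx : L (k, n) (f (set_val x)) 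
    by exists (set_val x) => //; split=> //; exact: set_valP.
  by exists (SigSub (mem_set Lx)) => //; apply: val_inj; rewrite /= fK.
Qed.
End Transfer.

Theorem corollary3p10 (R : realType) (X Y : topologicalType)
    (hX : perfectly_paracompact X) (hY : perfectly_paracompact Y)
    (hXY : weakly_homeomorphic X Y) :
  (exists K : Type, is_nw X K /\ is_nw Y K) /\
  (exists K : Type, is_hl X K /\ is_hl Y K) /\
  (exists K : Type, is_hd X K /\ is_hd Y K) /\
  covering_dim X = covering_dim Y /\
  (analytic R X <-> analytic R Y) /\
  (sigma_compact X <-> sigma_compact Y) /\
  (sigma_polish R X <-> sigma_polish R Y).
Proof.
have [f [g [F sF]]] := weakly_homeomorphic_sigma_homeo hX hY hXY.
have sF' := sigma_homeo_sym sF.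
have [[pX _] [pY _]] := (hX, hY).
have [[h2X _] [h2Y _]] := (pX, pY).
split; first exact: (nw_sigma_homeo h2X h2Y sF).
split; first exact: (hl_sigma_homeo h2X h2Y sF).
split; first exact: (hd_sigma_homeo h2X h2Y sF).
split.
  apply: (covering_dim_sigma_homeo _ _ sF); exact: paracompact_normal.
split; first by split; [exact: (analytic_transfer sF)|exact: (analytic_transfer sF')].
split; first by split;
  [exact: (sigma_compact_transfer sF)|exact: (sigma_compact_transfer sF')].
by split; [exact: (sigma_polish_transfer sF)|exact: (sigma_polish_transfer sF')].
Qed.
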